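(* Let $F_2$ be the free group of rank $2$ with a free basis $X$, and let $P \subset F_2$ be the set of all primitive elements of $F_2$. Then the exponential growth rate of $P$ satisfies $d_X(P) = \dfrac{1}{\sqrt{3}}$.
   Context: An element of the free group $F_p$ of rank $p$ is called primitive if it is a member of some generating set of $F_p$ containing exactly $p$ elements. Fix a free basis $X$ of $F_p$ (a free generating set with $p$ elements). The word length $|g|_X$ of $g \in F_p$ is the length of the reduced word in $X \cup X^{-1}$ representing $g$. For a subset $S \subseteq F_p$, the exponential growth rate of $S$ (in $F_p$, with respect to $X$) is defined by the normalized quantity $$d_X(S) = \limsup_{N \to \infty} \left[\frac{\#\{g \in S : |g|_X \le N\}}{\#\{g \in F_p : |g|_X \le N\}}\right]^{1/N}.$$ *)

(* Defs.v *)
From HB Require Import structures.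
From mathcomp Require Import all_boot all_order all_algebra finmap.
From mathcomp Require Import all_classical all_reals all_analysis.

Set Implicit Arguments.
Unset Strict Implicit.
Unset Printing Implicit Defensive.

Import Order.TTheory GRing.Theory Num.Theory.

Local Open Scope classical_set_scope.
Local Open Scope card_scope.

(* A word in X and X^-1 is a list of letters (x, b) with x in X; the letter
   (x, false) stands for x and (x, true) for x^-1. *)
Definition word (G : groupType) : Type := seq (G * bool).

Definition letter_value (G : groupType) (l : G * bool) : G :=
  if l.2 then (l.1^-1)%g else l.1.

Definition word_value (G : groupType) (w : word G) : G :=
  (\big[*%g/1]_(l <- w) letter_value l)%g.

Definition word_over (G : groupType) (X : set G) (w : word G) : Prop :=
  forall l : G * bool, l \in w -> X l.1.

Definition reduced (G : groupType) (w : word G) : bool :=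
  sorted (fun l m : G * bool => m != (l.1, ~~ l.2)) w.

Definition reduced_word_for (G : groupType) (X : set G) (g : G) (w : word G) :
    Prop :=
  [/\ word_over X w, reduced w & word_value w = g].

Definition free_basis (G : groupType) (p : nat) (X : set G) : Prop :=
  X #= `I_p /\ forall g : G, exists! w : word G, reduced_word_for X g w.

(* The default [::] is never used when X is a free basis. *)
Definition word_length (G : groupType) (X : set G) (g : G) : nat :=
  size (xget [::] [set w : seq (G * bool) | reduced_word_for X g w]).

Definition is_subgroup (G : groupType) (H : set G) : Prop :=
  H 1%g /\ forall x y : G, H x -> H y -> H (x / y)%g.

Definition generates (G : groupType) (B : set G) : Prop :=
  smallest (@is_subgroup G) B = [set: G].

(* The ambient group is meant to be free of rank p. *)
Definition primitive (G : groupType) (p : nat) (g : G) : Prop :=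
  exists B : set G, [/\ B #= `I_p, generates B & B g].

(* Balls are finite when X is a finite free basis, so that fset_set, which is
   empty on infinite sets, loses nothing. *)
Definition ball_count (G : groupType) (X S : set G) (N : nat) : nat :=
  #|` fset_set [set g : G | S g /\ (word_length X g <= N)%N]|%fset.

Definition growth_rate (R : realType) (G : groupType) (X S : set G) : \bar R :=
  limn_esup (fun N : nat =>
    ((((ball_count X S N)%:R / (ball_count X [set: G] N)%:R : R)
        `^ (N%:R^-1))%R)%:E).

(* Main.v *)
Require Import Defs.
From mathcomp Require Import all_boot all_order all_algebra finmap.
From mathcomp Require Import all_classical all_reals all_analysis.
From mathcomp Require Import zify ring lra.

Set Implicit Arguments.
Unset Strict Implicit.
Unset Printing Implicit Defensive.

(** Let x, y be the basis. Nielsen reduction, in which simultaneous conjugation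
  of the pair is allowed, brings every generating pair of F_2 to a pair made of
  x^{+-1} and y^{+-1} by elementary moves that decrease the sum of the lengths.
  Read backwards, these moves show that a primitive element is a conjugate of a
  word obtained from a letter by substitutions a := ab or b := ba, with
  a = x^{+-1} and b = y^{+-1}. In such a word one of the two letters is never
  repeated, even cyclically, so these words of length m are counted by a
  Fibonacci number, which is O(sqrt(3)^m). Writing a primitive element as a
  reduced word c z c^-1 with z of this kind, and counting 3^|c| choices for c,
  there are O(N^2 sqrt(3)^N) primitive elements of length at most N. The
  conjugates of x alone give a lower bound of order sqrt(3)^N, whereas the ball
  has 3^N elements up to a linear factor. *)

(** * Words *)

(* The letter (i, b) stands for the basis element number i, inverted if b. *)
Notation letter := (bool * bool)%type.

Definition flip (l : letter) : letter := (l.1, ~~ l.2).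
Definition noncancel (l m : letter) := m != flip l.
Definition winv (w : seq letter) := rev (map flip w).

Lemma flipK : involutive flip.
Proof. by case=> i b; rewrite /flip /= negbK. Qed.

Lemma flip_neq l : flip l != l.
Proof. by case: l => [[] []]. Qed.

Lemma noncancel_flip l m : noncancel (flip m) (flip l) = noncancel l m.
Proof. by case: l m => [[] []] [[] []]. Qed.

Lemma winvK : involutive winv.
Proof. by move=> w; rewrite /winv map_rev revK (mapK flipK). Qed.

Lemma size_winv w : size (winv w) = size w.
Proof. by rewrite size_rev size_map. Qed.

Lemma winv_cat u v : winv (u ++ v) = winv v ++ winv u.
Proof. by rewrite /winv map_cat rev_cat. Qed.

Lemma winv_cons l w : winv (l :: w) = rcons (winv w) (flip l).
Proof. by rewrite /winv /= rev_cons. Qed.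

Lemma sorted_winv w : sorted noncancel (winv w) = sorted noncancel w.
Proof.
rewrite rev_sorted sorted_map; apply: eq_sorted => l m /=.
by rewrite noncancel_flip.
Qed.

Lemma sorted_rcons_cat (T : Type) (e : rel T) (s t : seq T) x y :
  sorted e (rcons s x ++ y :: t) =
    [&& sorted e (rcons s x), e x y & sorted e (y :: t)].
Proof.
case: s => [|z s] /=; first by [].
by rewrite cat_path last_rcons.
Qed.

(** Free reduction: letters are pushed, from the right, onto a word that is already reduced. *)
Definition wpush (l : letter) (w : seq letter) :=
  if w is m :: w' then if m == flip l then w' else l :: w else [:: l].
Definition wred (w : seq letter) := foldr wpush [::] w.

Lemma wred_sorted w : sorted noncancel (wred w).
Proof.
elim: w => //= l w; case: (wred w) => //= m v; case: ifP => [_|/negbT ne].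
  by apply: path_sorted.
by rewrite /= /noncancel ne.
Qed.

Lemma size_wred w : size (wred w) <= size w.
Proof.
elim: w => //= l w; case: (wred w) => //= m v; case: ifP => _ /=; lia.
Qed.

Fixpoint lcp (T : eqType) (u v : seq T) : nat :=
  match u, v with
  | x :: u', y :: v' => if x == y then (lcp u' v').+1 else 0
  | _, _ => 0
  end.

Lemma lcpC (T : eqType) (u v : seq T) : lcp u v = lcp v u.
Proof. by elim: u v => [|x u IH] [|y v] //=; rewrite eq_sym IH. Qed.

(** The ultrametric inequality that expresses the 0-hyperbolicity of a tree. *)
Lemma lcp_ultra (T : eqType) (u v w : seq T) :
  minn (lcp u v) (lcp v w) <= lcp u w.
Proof.
elim: u v w => [|x u IH] [|y v] [|z w] //=; rewrite ?min0n ?minn0 //.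
case: (eqVneq x y) => [<-|_]; last by rewrite min0n.
by case: ifP => _; rewrite ?minn0 // minnSS ltnS.
Qed.

Lemma lcp_leq_size (T : eqType) (u v : seq T) : lcp u v <= size u.
Proof. by elim: u v => [|x u IH] [|y v] //=; case: ifP => //; rewrite ltnS. Qed.

Lemma take_lcp (T : eqType) (u v : seq T) n : n <= lcp u v -> take n u = take n v.
Proof.
elim: u v n => [|x u IH] [|y v] [|n] //=.
by case: eqP => // <- /IH ->.
Qed.

Lemma lcp_nth (T : eqType) (x0 : T) (u v : seq T) i :
  i < lcp u v -> nth x0 u i = nth x0 v i.
Proof.
by move=> lt; rewrite -(nth_take x0 lt) (take_lcp (leqnn _)) nth_take.
Qed.

(* A reduced word sharing its first half with its inverse would have a middle
   letter equal to its own inverse or two cancelling middle letters. *)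
Lemma lcp_winv (w : seq letter) :
  sorted noncancel w -> w != [::] -> (lcp w (winv w)).*2 < size w.
Proof.
move=> sw wn; rewrite ltnNge; apply/negP => le.
have x0 : letter := (true, true).
have w0 : 0 < size w by case: (w) wn.
pose i := (size w).-1./2.
have iL : i < lcp w (winv w) by rewrite /i; lia.
have := lcp_nth x0 iL.
have iw : i < size w by rewrite /i; lia.
rewrite nth_rev ?size_map // (nth_map x0); last by lia.
have [od|ev] := boolP (odd (size w)).
  have -> : size w - i.+1 = i by rewrite /i; lia.
  by move/eqP; rewrite eq_sym (negPf (flip_neq _)).
have -> : size w - i.+1 = i.+1 by rewrite /i; lia.
move=> E; have /(sortedP x0)/(_ i) := sw.
have -> : i.+1 < size w by rewrite /i; lia.
by move/(_ isT); rewrite /noncancel E flipK eqxx.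
Qed.

(** * Values of words in a group *)

Section Eval.
Variable G : groupType.
Implicit Types (a b : G) (w : seq letter).
Local Open Scope group_scope.

Definition lval a b (l : letter) : G :=
  let u := if l.1 then b else a in if l.2 then u^-1 else u.
Definition wval a b w : G := \big[*%g/1]_(l <- w) lval a b l.

Lemma lval_flip a b l : lval a b (flip l) = (lval a b l)^-1.
Proof. by case: l => i []; rewrite /lval /= ?invgK. Qed.

Lemma wval_nil a b : wval a b [::] = 1.
Proof. exact: big_nil. Qed.

Lemma wval_cons a b l w : wval a b (l :: w) = lval a b l * wval a b w.
Proof. exact: big_cons. Qed.

Lemma wval_cat a b u v : wval a b (u ++ v) = wval a b u * wval a b v.
Proof. exact: big_cat. Qed.

Lemma wval_rcons a b w l : wval a b (rcons w l) = wval a b w * lval a b l.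
Proof. by rewrite -cats1 wval_cat wval_cons wval_nil mulg1. Qed.

Lemma wval_winv a b w : wval a b (winv w) = (wval a b w)^-1.
Proof.
elim: w => [|l w IH]; first by rewrite wval_nil invg1.
by rewrite winv_cons wval_rcons wval_cons IH lval_flip invgM.
Qed.

Lemma wval_wred a b w : wval a b (wred w) = wval a b w.
Proof.
elim: w => //= l w; rewrite wval_cons => <-; rewrite /wpush.
case: (wred w) => [|m v]; first by rewrite wval_cons.
case: eqP => [->|_]; last by rewrite wval_cons.
by rewrite wval_cons lval_flip mulVKg.
Qed.
End Eval.

(** * Positive substitutions *)

Section Christoffel.
Variable G : groupType.
Implicit Types (a b c g p q : G).
Local Open Scope group_scope.

(* [g] is the value at [(p, q)] of a word obtained from a letter by the
   substitutions p := p * q and q := q * p. *)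
Inductive christoffel p q : G -> Prop :=
| Christoffel_l : christoffel p q p
| Christoffel_r : christoffel p q q
| Christoffel_subl g : christoffel (p * q) q g -> christoffel p q g
| Christoffel_subr g : christoffel p (q * p) g -> christoffel p q g.

Lemma christoffel_swap p q g : christoffel p q g -> christoffel q p g.
Proof.
elim=> {p q g} p q; [exact: Christoffel_r | exact: Christoffel_l | |].
  by move=> g _; exact: Christoffel_subr.
by move=> g _; exact: Christoffel_subl.
Qed.

Lemma christoffelJ p q g c :
  christoffel p q g -> christoffel (p ^ c) (q ^ c) (g ^ c).
Proof.
elim=> {p q g} p q; [exact: Christoffel_l | exact: Christoffel_r | |] => g _.
  by rewrite conjMg; exact: Christoffel_subl.
by rewrite conjMg; exact: Christoffel_subr.
Qed.

Definition sgn (s : bool) g := if s then g^-1 else g.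

(** The signs and the conjugator absorb inversions and conjugations of the pair, so that the
    relation survives every Nielsen move. *)
Definition conj_christoffel a b g :=
  exists c s t, christoffel (sgn s a) (sgn t b) (g ^ c).

Lemma sgnV s g : sgn s g^-1 = sgn (~~ s) g.
Proof. by case: s; rewrite /= ?invgK. Qed.

Lemma conj_christoffel_swap a b g :
  conj_christoffel a b g -> conj_christoffel b a g.
Proof. by move=> [c [s [t /christoffel_swap ?]]]; exists c, t, s. Qed.

Lemma conj_christoffelVl a b g :
  conj_christoffel a^-1 b g -> conj_christoffel a b g.
Proof. by move=> [c [s [t]]]; rewrite sgnV => ?; exists c, (~~ s), t. Qed.

Lemma conj_christoffelVr a b g :
  conj_christoffel a b^-1 g -> conj_christoffel a b g.
Proof. by move=> [c [s [t]]]; rewrite sgnV => ?; exists c, s, (~~ t). Qed.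

Lemma conj_christoffelJg a b g c :
  conj_christoffel a b (g ^ c) -> conj_christoffel a b g.
Proof. by move=> [d [s [t]]]; rewrite -conjgM => ?; exists (c * d), s, t. Qed.

Lemma conj_christoffelJ a b g c :
  conj_christoffel (a ^ c) (b ^ c) g -> conj_christoffel a b g.
Proof.
move=> [d [s [t]]] /(christoffelJ c^-1).
have sgnJ u h : sgn u (h ^ c) = sgn u h ^ c by case: u; rewrite //= conjVg.
by rewrite !sgnJ !conjgK -conjgM => ?; exists (d * c^-1), s, t.
Qed.

Lemma christoffel_conj a b s t g :
  christoffel (sgn s a) (sgn t b) g -> conj_christoffel a b g.
Proof. by move=> ?; exists 1, s, t; rewrite conjg1. Qed.

(* The outermost substitution decides: b := b * a on the pair (a * b, b^-1)
   leads to (b * a, a) up to conjugacy, hence to a positive word in (a, b); all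
   other cases, but the letter a * b, lead to positive words in (a, b^-1). *)
Lemma christoffel_mixed a b g :
  christoffel (a * b) b^-1 g -> conj_christoffel a b g.
Proof.
case=> [||{}g|{}g].
- apply: (@christoffel_conj _ _ false false).
  by apply: Christoffel_subl; exact: Christoffel_l.
- by apply: (@christoffel_conj _ _ false true); exact: Christoffel_r.
- by rewrite mulgK; exact: (@christoffel_conj _ _ false true).
move=> /(christoffelJ b^-1); rewrite !conjgE !invgK !mulgA mulgV mul1g !mulgK.
move=> /christoffel_swap H; have {}H := Christoffel_subr H.
apply: (@conj_christoffelJg _ _ _ b^-1).
by rewrite conjgE invgK mulgA; exact: (@christoffel_conj _ _ false false).
Qed.

(** Equal signs give an outermost substitution, after conjugation by [b^-1] if both are negative.
    Opposite signs reduce to [christoffel_mixed] for [(a, b)] or for [(a^-1, b^-1)]. *)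
Lemma conj_christoffelM a b g :
  conj_christoffel (a * b) b g -> conj_christoffel a b g.
Proof.
have swapV (d e h : G) : christoffel (d * e)^-1 e^-1 h ->
    christoffel (d^-1 * e^-1) e^-1 (h ^ e^-1).
  move=> /(christoffelJ e^-1); rewrite !conjgE invgM !invgK !mulgA.
  by rewrite !mulgV !mul1g.
move=> [c [[] [[] /=]]] H; apply: (@conj_christoffelJg _ _ _ c).
- apply: (@conj_christoffelJg _ _ _ b^-1).
  by apply: (@christoffel_conj _ _ true true); apply: Christoffel_subl; exact: swapV.
- apply/conj_christoffelVl/conj_christoffelVr.
  apply: (@conj_christoffelJg _ _ _ b^-1).
  apply: christoffel_mixed; rewrite invgK.
  move: H => /(christoffelJ b^-1); rewrite !conjgE invgM !invgK !mulgA.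
  by rewrite !mulgV !mul1g mulgK.
- exact: christoffel_mixed.
- by apply: (@christoffel_conj _ _ false false); exact: Christoffel_subl.
Qed.

End Christoffel.

(** * Nielsen reduction of generating pairs *)

Section Free.
Variables (G : groupType) (x y : G) (nf : G -> seq letter).
Implicit Types (a b c g h : G) (l m k : letter) (w : seq letter).
Local Open Scope group_scope.

(** The group is free on [x] and [y], and [nf g] is the reduced word of [g]. *)
Hypothesis nf_sorted : forall g, sorted noncancel (nf g).
Hypothesis nfK : forall g, wval x y (nf g) = g.
Hypothesis wvalK : forall w, sorted noncancel w -> nf (wval x y w) = w.

Definition len g := size (nf g).
(** The Gromov product based at 1 in the Cayley tree. *)
Definition gromov g h := lcp (nf g) (nf h).

Lemma nfV g : nf g^-1 = winv (nf g).
Proof. by rewrite -{1}[g]nfK -wval_winv wvalK ?sorted_winv. Qed.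

Lemma lenV g : len g^-1 = len g.
Proof. by rewrite /len nfV size_winv. Qed.

Lemma len_wval w : len (wval x y w) <= size w.
Proof. by rewrite /len -wval_wred wvalK ?wred_sorted ?size_wred. Qed.

Lemma len_gt0 g : g <> 1 -> 0 < len g.
Proof.
move=> g1; rewrite lt0n size_eq0; apply/eqP => E; apply: g1.
by rewrite -[g]nfK E wval_nil.
Qed.

(** Past the common prefix the next letters differ, so nothing cancels where the remainders meet. *)
Lemma sorted_drop_lcp (u v : seq letter) :
  sorted noncancel u -> sorted noncancel v ->
  sorted noncancel (winv (drop (lcp u v) u) ++ drop (lcp u v) v).
Proof.
elim: u v => [|l u IH] [|m v] //= su sv.
  by rewrite cats0 sorted_winv.
case: eqVneq => [_|ne] /=.
  by apply: IH; [exact: path_sorted su | exact: path_sorted sv].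
rewrite winv_cons sorted_rcons_cat -winv_cons. rewrite sorted_winv /= su sv andbT.
by rewrite /noncancel flipK eq_sym.
Qed.

(** The common prefix is all that cancels in [g^-1 * h], once in each factor. *)
Lemma len_divl g h : len (g^-1 * h) + (gromov g h).*2 = len g + len h.
Proof.
have /wvalK := sorted_drop_lcp (nf_sorted g) (nf_sorted h).
rewrite wval_cat wval_winv -/(gromov g h); set n := gromov g h => E.
have -> : g^-1 * h = (wval x y (drop n (nf g)))^-1 * wval x y (drop n (nf h)).
  have eg := nfK g; have eh := nfK h.
  rewrite -(cat_take_drop n (nf g)) wval_cat in eg.
  rewrite -(cat_take_drop n (nf h)) wval_cat in eh.
  rewrite -{1}eg -{1}eh (take_lcp (leqnn n) : take n (nf g) = take n (nf h)).
  by rewrite invgM -mulgA mulKg.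
rewrite /len E size_cat size_winv !size_drop.
have : n <= size (nf g) by exact: lcp_leq_size.
have : n <= size (nf h) by rewrite /n /gromov lcpC; exact: lcp_leq_size.
by rewrite -/n; lia.
Qed.

Lemma gromovC g h : gromov g h = gromov h g.
Proof. exact: lcpC. Qed.

Lemma gromov_ultra g h c : minn (gromov g h) (gromov h c) <= gromov g c.
Proof. exact: lcp_ultra. Qed.

Lemma gromovV g : g <> 1 -> (gromov g g^-1).*2 < len g.
Proof.
move=> /len_gt0; rewrite /gromov nfV /len => g0.
by apply: lcp_winv => //; rewrite -size_eq0 -lt0n.
Qed.

(** * Nielsen reduced pairs *)

Section NielsenReduced.
Variables a b : G.
Local Notation U := (lval a b).

(** In a reduced product [U (flip l) * U m * U k], the pieces of [U m] that cancel against its two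
    neighbours do not exhaust it. *)
Hypothesis U_overlap : forall l m k, l != m -> k != flip m ->
  gromov (U l) (U m) + gromov (U (flip m)) (U k) < len (U m).

Lemma gromov_lt_len l m : l != m -> gromov (U l) (U m) < len (U m).
Proof.
move=> lm; have := U_overlap (k := m) lm.
by rewrite eq_sym flip_neq => /(_ isT); lia.
Qed.

(** Here [d] bounds what [U l] loses to the letters after it. What remains is longer than the
    overlap of [U l] with any other [U k], so it alone decides what a factor put in front cancels,
    and every letter of the word contributes to the length. *)
Lemma wval_reduced l w (W := wval a b (l :: w)) : path noncancel l w ->
  (forall k, k != l -> gromov (U k) W = gromov (U k) (U l)) /\
  exists2 d, size w + len (U l) <= len W + d &
    forall k, k != l -> gromov (U k) (U l) + d < len (U l).
Proof.
rewrite {}/W; elim: w l => [|m w IH] l.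
  move=> _; rewrite wval_cons wval_nil mulg1; split=> //; exists 0.
    by rewrite addn0.
  by move=> k kl; rewrite addn0; exact: gromov_lt_len.
move=> /= /andP[lm /IH {IH}[gW [d' sz gd']]].
rewrite wval_cons; set W' := wval _ _ (m :: w) in gW sz *.
have fl : flip l != m by rewrite eq_sym.
set d := gromov (U (flip l)) (U m).
have dlt k : k != l -> gromov (U k) (U l) + d < len (U l).
  by move=> kl; apply: U_overlap.
(* [E1] and [E2] together show that [U l] and [U l * W'] share all but the last [d] letters of
   [U l]. *)
have E1 : len (U l * W') + d.*2 = len (U l) + len W'.
  by have := len_divl (U l)^-1 W'; rewrite invgK lenV -lval_flip gW.
have E2 : len W' + (gromov (U l) (U l * W')).*2 = len (U l) + len (U l * W').
  by rewrite -len_divl mulKg.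
have := gd' _ fl; rewrite -/d => lt.
split.
  move=> k /dlt kl.
  (* [U k] leaves [U l] before that shared prefix ends, so the two ultrametric inequalities force
     equality. *)
  have := gromov_ultra (U k) (U l) (U l * W').
  have := gromov_ultra (U k) (U l * W') (U l).
  by rewrite (gromovC (U l * W') (U l)); lia.
by exists d => //=; lia.
Qed.

Lemma size_le_len w : sorted noncancel w -> size w <= len (wval a b w).
Proof.
case: w => [|l w] //= /wval_reduced[_ [d sz]] /(_ (flip l) (flip_neq l)); lia.
Qed.

End NielsenReduced.

(** * Generating pairs and Nielsen moves *)

Definition gen2 a b := forall g, exists w, wval a b w = g.

Lemma gen2_sub a b c d : gen2 a b ->
  (exists w, wval c d w = a) -> (exists w, wval c d w = b) -> gen2 c d.
Proof.
move=> gen [u ua] [v vb] g; have [w <-] := gen g.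
elim: w => [|l w [t tw]]; first by exists [::]; rewrite !wval_nil.
exists ((let r := if l.1 then v else u in if l.2 then winv r else r) ++ t).
rewrite wval_cat tw wval_cons; congr (_ * _); rewrite /lval.
by case: l.1; case: l.2; rewrite /= ?wval_winv ?ua ?vb.
Qed.

Lemma wval1 a b l : wval a b [:: l] = lval a b l.
Proof. by rewrite wval_cons wval_nil mulg1. Qed.

Lemma wvalJ a b c w : wval (a ^ c) (b ^ c) w = wval a b w ^ c.
Proof.
elim: w => [|l w IH]; first by rewrite !wval_nil conj1g.
rewrite !wval_cons conjMg IH; congr (_ * _).
by case: l => [[] []]; rewrite /lval /= ?conjVg.
Qed.

Lemma gen2J a b c : gen2 a b -> gen2 (a ^ c) (b ^ c).
Proof.
move=> gen g; have [w ew] := gen (g ^ c^-1); exists w.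
by rewrite wvalJ ew conjgKV.
Qed.

Lemma gen2_lval a b l m :
  l.1 != m.1 -> gen2 a b -> gen2 (lval a b l) (lval a b m).
Proof.
move=> lm gen; apply: (gen2_sub gen).
  exists [:: if l.1 then (true, m.2) else (false, l.2)].
  by rewrite wval1; case: l m lm => [[] []] [[] []]; rewrite /lval /= ?invgK.
exists [:: if l.1 then (false, l.2) else (true, m.2)].
by rewrite wval1; case: l m lm => [[] []] [[] []]; rewrite /lval /= ?invgK.
Qed.

Lemma gen2M a b : gen2 (a * b) b -> gen2 a b.
Proof.
move=> gen; apply: (gen2_sub gen).
  by exists [:: (false, false); (true, false)]; rewrite wval_cons wval1.
by exists [:: (true, false)]; rewrite wval1.
Qed.

Lemma conj_christoffel_lval a b l m z : l.1 != m.1 ->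
  conj_christoffel a b z -> conj_christoffel (lval a b l) (lval a b m) z.
Proof.
have Vl c d : conj_christoffel c d z -> conj_christoffel c^-1 d z.
  by move=> H; apply: conj_christoffelVl; rewrite invgK.
have Vr c d : conj_christoffel c d z -> conj_christoffel c d^-1 z.
  by move=> H; apply: conj_christoffelVr; rewrite invgK.
move=> lm H; have Hs := conj_christoffel_swap H.
case: l m lm => [[] []] [[] []] // _; rewrite /lval /=;
  by do ?[exact: H | exact: Hs | apply: Vl | apply: Vr].
Qed.

Lemma commute_wval a b w c :
  commute a c -> commute b c -> commute (wval a b w) c.
Proof.
move=> ac bc; elim: w => [|l w IH].
  by rewrite wval_nil; apply: commute_sym; exact: commute1.
rewrite wval_cons; apply/commute_sym/commuteM; last exact: commute_sym.
rewrite /lval; case: l.1; case: l.2; rewrite /=; try exact: commute_sym.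
  by apply: commuteV; exact: commute_sym.
by apply: commuteV; exact: commute_sym.
Qed.

Lemma nf_lval l : nf (lval x y l) = [:: l].
Proof. by rewrite -wval1 wvalK. Qed.

Lemma lval_inj : injective (lval x y).
Proof. by move=> l m /(congr1 nf); rewrite !nf_lval => -[]. Qed.

(** Otherwise [x] and [y] would commute, although [x * y] and [y * x] have different normal forms.
    This keeps trivial elements out of generating pairs. *)
Lemma gen2_noncommute a b : gen2 a b -> ~ commute a b.
Proof.
move=> gen ab.
have comm_b g : commute g b by have [w <-] := gen g; exact: commute_wval.
have comm_a g : commute g a.
  by have [w <-] := gen g; apply: commute_wval => //; exact: commute_sym.
have : commute y x.
  have [u <-] := gen y; apply: commute_wval; apply: commute_sym.
    exact: comm_a.
  exact: comm_b.
rewrite /commute => E.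
have : nf (y * x) = nf (x * y) by rewrite E.
have -> : y * x = wval x y [:: (true, false); (false, false)].
  by rewrite wval_cons wval1.
have -> : x * y = wval x y [:: (false, false); (true, false)].
  by rewrite wval_cons wval1.
by rewrite !wvalK.
Qed.

(** The invariant of the reduction: [z] stays fixed while the pair gets shorter. *)
Definition gen_christoffel z a b := gen2 a b /\ conj_christoffel a b z.

Lemma gen_christoffelM z a b :
  gen_christoffel z (a * b) b -> gen_christoffel z a b.
Proof. by move=> [/gen2M ? /conj_christoffelM]. Qed.

Lemma gen_christoffelJ z a b c :
  gen_christoffel z a b -> gen_christoffel z (a ^ c) (b ^ c).
Proof.
move=> [gen H]; split; first exact: gen2J.
by apply: (@conj_christoffelJ _ _ _ _ c^-1); rewrite !conjgK.
Qed.

Lemma gen_christoffel_lval z a b l m : l.1 != m.1 ->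
  gen_christoffel z a b -> gen_christoffel z (lval a b l) (lval a b m).
Proof.
move=> lm [gen H].
by split; [exact: gen2_lval | exact: conj_christoffel_lval].
Qed.

(** The move [a := a * b^-1], followed by conjugation by [b]. *)
Lemma gen_christoffel_divl z a b :
  gen_christoffel z a b -> gen_christoffel z (b^-1 * a) b.
Proof.
move=> H; have {}H : gen_christoffel z (a * b^-1 * b) b by rewrite mulgVK.
have /(gen_christoffelJ b) := gen_christoffelM H.
by rewrite !conjgE !mulgVK mulKg.
Qed.

Lemma len_lval a b l : len (lval a b l) = if l.1 then len b else len a.
Proof. by rewrite /lval; case: l.1; case: l.2; rewrite ?lenV. Qed.

(* When both halves of [g] are cancelled, by [h] on the left and by [h^-1] on
   the right, write g = p q^-1 and h = p r q^-1; conjugating by [p] gives the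
   pair (q^-1 p, r q^-1 p), and then r replaces r q^-1 p. *)
Lemma gen_christoffel_overlap z g h : gen_christoffel z h g ->
  len g <= len h -> (gromov h g).*2 = len g ->
  (gromov h^-1 g^-1).*2 = len g ->
  exists a b, len a + len b <= len h /\ gen_christoffel z a b.
Proof.
move=> H gh E1 E2.
set n := gromov h g; set P := take n (nf g); set Q := drop n (nf g).
have Eg : nf g = P ++ Q by rewrite cat_take_drop.
have sP : size P = n by rewrite size_takel //; move: E1; rewrite -/n /len; lia.
have sQ : size Q = n by rewrite size_drop; move: E1; rewrite -/n /len; lia.
have EP : take n (nf h) = P by apply: take_lcp.
have : take n (nf h^-1) = take n (nf g^-1).
  by apply: take_lcp; rewrite -[lcp _ _]/(gromov _ _); lia.
rewrite !nfV [X in _ = _ _ (winv X)]Eg winv_cat.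
rewrite (@take_cat _ _ (winv Q)) size_winv sQ ltnn subnn take0 cats0.
move=> EQ.
have {}EQ : drop (len h - n) (nf h) = Q.
  by apply: (can_inj winvK); rewrite -EQ /winv take_rev size_map map_drop.
pose S := drop n (take (len h - n) (nf h)).
have Eh : nf h = P ++ S ++ Q.
  rewrite -EQ -EP catA -{1}(cat_take_drop (len h - n) (nf h)); congr (_ ++ _).
  rewrite /S -{1}(cat_take_drop n (take _ _)) take_takel //.
  by move: E1; rewrite -/n; lia.
(* [P], [S] and [Q] spell p, r and q^-1, so the new pair is (r, q^-1 p). *)
exists (wval x y S), (wval x y (Q ++ P)); split.
  have := len_wval S; have := len_wval (Q ++ P).
  have : len h = (size P + (size S + size Q))%N by rewrite /len Eh !size_cat.
  by rewrite size_cat; lia.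
apply: gen_christoffelM.
have /(gen_christoffelJ (wval x y P)) := H.
rewrite -{1}[g]nfK -{1}[h]nfK Eg Eh !wval_cat !conjgE -!mulgA !mulKg.
by [].
Qed.

(** Induction on the total length. As long as the pair is not Nielsen reduced, one of two moves
    shortens it; a Nielsen reduced generating pair is the basis up to order and inversion. *)
Lemma gen_christoffel_basis z a b :
  gen_christoffel z a b -> conj_christoffel x y z.
Proof.
have [n] := ubnP (len a + len b); elim: n a b => // n IH a b ltn H.
pose U := lval a b; have [gen _] := H.
have sumU l m : l.1 != m.1 -> len (U l) + len (U m) = len a + len b.
  by rewrite /U !len_lval; case: l m => [[] ?] [[] ?] // _; rewrite addnC.
have U1 l : U l <> 1.
  have a1 : a <> 1.
    by move=> E; apply: (gen2_noncommute gen); rewrite E; apply/commute_sym/commute1.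
  have b1 : b <> 1.
    by move=> E; apply: (gen2_noncommute gen); rewrite E; apply/commute1.
  by case: l => [[] []]; rewrite /U /lval //= => /eqP; rewrite invg_eq1 => /eqP.
(* If more than half of [U m] is a prefix of [U l], removing [U m] from the front of [U l] shortens
   the pair. *)
have [/existsP[l /existsP[m /andP[lm lt]]]|] := boolP [exists l : letter,
  [exists m : letter, (l.1 != m.1) && (len (U m) < (gromov (U l) (U m)).*2)]].
  apply: (IH ((U m)^-1 * U l) (U m)).
    by have := len_divl (U m) (U l); rewrite (gromovC (U m)); have := sumU _ _ lm; lia.
  exact/gen_christoffel_divl/gen_christoffel_lval.
rewrite negb_exists => /forallP half0.
have half l m : l.1 != m.1 -> (gromov (U l) (U m)).*2 <= len (U m).
  move=> lm; have := half0 l; rewrite negb_exists => /forallP/(_ m).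
  by rewrite lm /= -leqNgt.
have half_flip m : (gromov (U m) (U (flip m))).*2 < len (U m).
  by rewrite /U lval_flip; exact: gromovV.
have cases l m : l != m -> l.1 != m.1 \/ l = flip m.
  by case: l m => [[] []] [[] []] // _; (by left) || (by right).
(* Otherwise each overlap is at most half of [U m], so two overlaps that exhaust [U m] are exactly
   its two halves. *)
have [/existsP[l /existsP[m /existsP[k /and3P[lm km le]]]]|] := boolP
  [exists l : letter, [exists m : letter, [exists k : letter,
    [&& l != m, k != flip m &
     len (U m) <= gromov (U l) (U m) + gromov (U (flip m)) (U k)]]]].
  have flm := half_flip m.
  have hlm : (gromov (U l) (U m)).*2 <= len (U m).
    by have [/half //|->] := cases _ _ lm; rewrite gromovC; exact: ltnW.
  have hkm : (gromov (U (flip m)) (U k)).*2 <= len (U m).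
    have [/half|->] := cases _ _ km; last by rewrite flipK gromovC; exact: ltnW.
    by rewrite gromovC /U lval_flip lenV.
  have {}lm : l.1 != m.1.
    by have [//|E] := cases _ _ lm; move: le;
      rewrite E (gromovC (U (flip m)) (U m)); lia.
  have {}km : k.1 != m.1.
    by have [//|E] := cases _ _ km; move: le;
      rewrite E flipK (gromovC (U (flip m)) (U m)); lia.
  (* If [k] were [l], then [U m] and its inverse would both share half their length with [U l],
     hence with each other, against [gromovV]. *)
  have kl : k = flip l.
    have [] // : k = l \/ k = flip l.
      by case: k l m {le flm hlm hkm} lm km => [[] []] [[] []] [[] []] // _ _;
        (by left) || (by right).
    move=> E; move: hkm le (gromov_ultra (U m) (U l) (U (flip m))).
    by rewrite E (gromovC (U m)) (gromovC (U l) (U (flip m))); lia.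
  have Vml : gromov (U (flip m)) (U k) = gromov (U l)^-1 (U m)^-1.
    by rewrite kl gromovC /U !lval_flip.
  rewrite Vml in hkm le.
  (* Half of [U m] is at most half of [U l], so [U m] is the shorter one. *)
  have := half m l; rewrite eq_sym gromovC => /(_ lm) ml.
  have [||| c [d [cd H']]] :=
    gen_christoffel_overlap
      (gen_christoffel_lval lm H : gen_christoffel z (U l) (U m)).
  - by lia.
  - by lia.
  - by lia.
  by apply: IH H'; have := len_gt0 (U1 m); have := sumU _ _ lm; lia.
move=> nov.
have size_le w : sorted noncancel w -> size w <= len (wval a b w).
  apply: size_le_len => l m k lm km; rewrite ltnNge; apply: contra nov => le.
  apply/existsP; exists l; apply/existsP; exists m.
  by apply/existsP; exists k; apply/and3P.
(* A basis element has length 1, so a reduced word in [a] and [b] that represents it has at most one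
   letter, and it is not empty. *)
have letter_of l : exists m, U m = lval x y l.
  have [w0 /esym] := gen (lval x y l); rewrite -wval_wred.
  have := wred_sorted w0; move: (wred w0) => w /size_le sz E.
  move: sz; rewrite -E /len nf_lval; case: w E => [|m [|//]] E _.
    by move: (congr1 nf E); rewrite nf_lval wval_nil -(wval_nil x y) wvalK.
  by exists m; rewrite E wval1.
have [l ul] := letter_of (false, false).
have [m um] := letter_of (true, false).
(* Otherwise [y] would be [x] or its inverse. *)
have lm : l.1 != m.1.
  apply/eqP => E; have [ml|ml] : m = l \/ m = flip l.
  - by case: l m E {ul um} => [[] []] [[] []] //= _; (by left) || (by right).
  - by have := lval_inj (etrans (esym ul) (etrans (congr1 U (esym ml)) um)).
  - have := lval_flip a b l; rewrite -ml -/(U m) -/(U l) um ul -lval_flip.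
    by move/lval_inj.
by have [] := gen_christoffel_lval lm H; rewrite -/(U l) -/(U m) ul um.
Qed.
End Free.

(** * Positive words and their conjugates *)

Section PositiveWords.
Variable G : groupType.
Implicit Types (p q g : G) (s : seq bool).
Local Open Scope group_scope.

Definition pval p q s := wval p q [seq (i, false) | i <- s].

Lemma pval_cons p q i s : pval p q (i :: s) = (if i then q else p) * pval p q s.
Proof. exact: wval_cons. Qed.

Lemma pval_negb p q s : pval p q (map negb s) = pval q p s.
Proof.
elim: s => [|i s IH]; first by rewrite /pval !wval_nil.
by rewrite /= !pval_cons IH; case: i.
Qed.

(** The substitution p := p * q, with [false] for p and [true] for q. *)
Definition expand s :=
  flatten [seq if i then [:: true] else [:: false; true] | i <- s].

Lemma pval_expand p q s : pval p q (expand s) = pval (p * q) q s.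
Proof.
elim: s => [|[] s IH]; first by rewrite /pval !wval_nil.
  by rewrite /= !pval_cons -IH.
by rewrite /= !pval_cons -IH mulgA.
Qed.

Lemma expand_nil s : (expand s == [::]) = (s == [::]).
Proof. by case: s => [|[] s]. Qed.

(** [cycle orb] forbids two cyclically adjacent [false]; after expansion every [false] is followed
    by [true]. *)
Lemma cycle_orb_expand s : cycle orb (expand s).
Proof.
have : path orb true (expand s) /\ last true (expand s) = true.
  by elim: s => [|[] s] //=.
by case: (expand s) => [|i t] //= [] it E; rewrite rcons_path it E.
Qed.

Lemma christoffel_pval p q g : christoffel p q g ->
  exists2 s, s != [::] & g = pval p q s.
Proof.
elim=> {p q g} [p q|p q|p q g _ [s s0 ->]|p q g _ [s s0 ->]].
- by exists [:: false]; rewrite // pval_cons /pval wval_nil mulg1.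
- by exists [:: true]; rewrite // pval_cons /pval wval_nil mulg1.
- by exists (expand s); rewrite ?expand_nil ?pval_expand.
exists (map negb (expand (map negb s))).
  by rewrite -size_eq0 size_map size_eq0 expand_nil -size_eq0 size_map size_eq0.
by rewrite pval_negb pval_expand pval_negb.
Qed.

(** Only the outermost substitution matters, since it expands the whole word. A single letter is
    spelled [[:: true]], because [[:: false]] is cyclically adjacent to itself. *)
Lemma christoffel_cycle p q g : christoffel p q g ->
  exists2 s, (s != [::]) && cycle orb s & g = pval p q s \/ g = pval q p s.
Proof.
case=> [||{}g /christoffel_pval[s s0 ->]|{}g /christoffel_pval[s s0 ->]].
- by exists [:: true] => //; right; rewrite pval_cons /pval wval_nil mulg1.
- by exists [:: true] => //; left; rewrite pval_cons /pval wval_nil mulg1.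
- exists (expand s); first by rewrite expand_nil s0 cycle_orb_expand.
  by left; rewrite pval_expand.
exists (expand (map negb s)).
  by rewrite expand_nil cycle_orb_expand -size_eq0 size_map size_eq0 s0.
by right; rewrite pval_expand pval_negb.
Qed.

Definition spell (l m : letter) s := [seq if i then m else l | i <- s].

Lemma pval_lval (x y : G) l m s :
  pval (lval x y l) (lval x y m) s = wval x y (spell l m s).
Proof.
elim: s => [|i s IH]; first by rewrite /pval !wval_nil.
by rewrite pval_cons IH /= wval_cons; case: i.
Qed.

Lemma conj_christoffel_word (x y g : G) : conj_christoffel x y g ->
  exists c l m s, [/\ l.1 != m.1, s != [::], cycle orb s &
    g = c * wval x y (spell l m s) * c^-1].
Proof.
move=> [c [s [t /christoffel_cycle[u /andP[u0 cu] E]]]]; exists c.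
have {E}[E|E] := E; [exists (false, s), (true, t), u|exists (true, t), (false, s), u].
  by split=> //; rewrite -pval_lval -E conjgE !mulgA mulgV mul1g mulgK.
by split=> //; rewrite -pval_lval -E conjgE !mulgA mulgV mul1g mulgK.
Qed.

Lemma sorted_spell l m s : l.1 != m.1 -> sorted noncancel (spell l m s).
Proof.
case: s => [|i s] //= lm; elim: s i => [|j s IH] i //=; rewrite IH andbT.
by case: i j l m lm {IH} => [] [] [[] []] [[] []].
Qed.

(** When the middle word cancels against the last letter of [c] or its inverse, the effect is to
    shorten [c] and rotate the middle word; rotation preserves size and the cyclic condition. *)
Lemma conj_word_reduced (x y : G) l m s c : l.1 != m.1 -> s != [::] ->
  cycle orb s -> sorted noncancel c ->
  exists c' s', [/\ size s' = size s, cycle orb s',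
    sorted noncancel (c' ++ spell l m s' ++ winv c') &
    wval x y c * wval x y (spell l m s) * (wval x y c)^-1 =
    wval x y (c' ++ spell l m s' ++ winv c')].
Proof.
move=> lm; elim/last_ind: c s => [|c k IH] s s0 cs sc.
  exists [::], s; rewrite /= cats0 sorted_spell //.
  by rewrite wval_nil mul1g invg1 mulg1.
have sc' : sorted noncancel c.
  by move: sc; rewrite -cats1 => /cat_sorted2[].
have Wk : wval x y (rcons c k) = wval x y c * lval x y k by rewrite wval_rcons.
case: (lastP s) s0 cs => // s1 j _ cs.
(* The last letter of the middle word cancels against [flip k], and [k] takes its place in front. *)
have [ek|nk] := eqVneq (if j then m else l) k.
  have cs' : cycle orb (j :: s1) by move: cs; rewrite -rot1_cons rot_cycle.
  have [c' [s' [sz ? ? E]]] := IH (j :: s1) isT cs' sc'.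
  exists c', s'; split; rewrite ?sz ?size_rcons // -E Wk /spell map_rcons /= ek.
  by rewrite wval_rcons wval_cons invgM !mulgA mulgK.
(* The mirror case, with cancellation on the left; [head j s1] is the first entry of [rcons s1 j]
   even if [s1] is empty. *)
have {}IH : (if head j s1 then m else l) = flip k ->
    exists c' s', [/\ size s' = (size s1).+1, cycle orb s',
    sorted noncancel (c' ++ spell l m s' ++ winv c') &
    wval x y (rcons c k) * wval x y (spell l m (rcons s1 j)) *
      (wval x y (rcons c k))^-1 =
    wval x y (c' ++ spell l m s' ++ winv c')].
  have [i [s2 Es]] : exists i s2, rcons s1 j = i :: s2.
    by case: s1 {cs} => [|i s2]; [exists j, [::] | exists i, (rcons s2 j)].
  have -> : head j s1 = i by case: s1 Es {cs} => [|? ?] [].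
  have -> : (size s1).+1 = (size s2).+1 by rewrite -(size_rcons s1 j) Es.
  rewrite Es in cs *; move=> ek.
  have cs' : cycle orb (rcons s2 i) by rewrite -rot1_cons rot_cycle.
  have [|c' [s' [sz ? ? E]]] := IH (rcons s2 i) _ cs' sc'; first by case: (s2).
  exists c', s'; split; rewrite ?sz ?size_rcons // -E Wk /spell map_rcons /= ek.
  by rewrite wval_rcons wval_cons lval_flip invgM !mulgA mulgK.
have [ek|nk'] := eqVneq (if head j s1 then m else l) (flip k).
  by have := IH ek; rewrite size_rcons.
exists (rcons c k), (rcons s1 j); split=> //; last first.
  by rewrite !wval_cat wval_winv !mulgA.
have Ew : winv (rcons c k) = flip k :: winv c by rewrite -cats1 winv_cat.
have Ej : spell l m (rcons s1 j) = rcons (spell l m s1) (if j then m else l).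
  by rewrite /spell map_rcons.
have : sorted noncancel (spell l m (rcons s1 j) ++ winv (rcons c k)).
  rewrite Ew Ej sorted_rcons_cat -Ej sorted_spell // -Ew sorted_winv sc andbT.
  by rewrite /= /noncancel (inj_eq (can_inj flipK)) eq_sym.
have [f [t [-> fk]]] : exists f t,
    spell l m (rcons s1 j) = f :: t /\ f != flip k.
  by case: (s1) nk' => [|i s2] nk'; do 2!eexists; split; first reflexivity.
by rewrite cat_cons sorted_rcons_cat sc /noncancel fk => ->.
Qed.
End PositiveWords.

(** * Enumerations of words *)

(* The three letters that may follow [l] are coded by [option bool]. *)
Definition next_letter (l : letter) (o : option bool) : letter :=
  if o is Some b then (~~ l.1, b) else l.

Lemma path_scanl_next l s : path noncancel l (scanl next_letter l s).
Proof.
by elim: s l => //= o s IH l; rewrite IH andbT; case: o l => [[]|] [[] []].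
Qed.

Lemma scanl_next_inj l : injective (scanl next_letter l).
Proof.
move=> s t; elim: s t l => [|o s IH] [|o' t] l //= [E]; rewrite E => /IH ->.
by congr (_ :: _); case: o o' l E => [[]|] [[]|] [[] []].
Qed.

Lemma scanl_next_surj l w : path noncancel l w ->
  exists s, scanl next_letter l s = w.
Proof.
elim: w l => [|m w IH] l /=; first by exists [::].
case/andP=> lm /IH[s Es].
exists ((if l.1 == m.1 then None else Some m.2) :: s).
have E : next_letter l (if l.1 == m.1 then None else Some m.2) = m.
  by case: l m lm {Es} => [[] []] [[] []].
by rewrite /= E Es.
Qed.

Definition codes n : seq (seq (option bool)) :=
  [seq tval t | t <- enum {: n.-tuple (option bool)}].

Lemma size_codes n : size (codes n) = 3 ^ n.
Proof. by rewrite size_map -cardE card_tuple card_option card_bool. Qed.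

Lemma codes_uniq n : uniq (codes n).
Proof. by rewrite map_inj_uniq ?enum_uniq //; exact: val_inj. Qed.

Lemma mem_codes n s : (s \in codes n) = (size s == n).
Proof.
apply/mapP/eqP => [[t _ ->]|sn]; first exact: size_tuple.
by exists (tcast sn (in_tuple s)); rewrite ?mem_enum // val_tcast.
Qed.

(** Repetitions are harmless for upper bounds: cutting [n.+1] letters down to [n] avoids an
    exception at 0. *)
Definition reduced_words n : seq (seq letter) :=
  [seq take n (l :: scanl next_letter l s) | l <- enum {: letter}, s <- codes n].

Lemma size_reduced_words n : size (reduced_words n) = 4 * 3 ^ n.
Proof. by rewrite size_allpairs size_codes -cardE card_prod card_bool. Qed.

(** Padding with the code [None] repeats the last letter and so keeps the word reduced. *)
Lemma reduced_words_prefix n w : sorted noncancel w -> size w <= n ->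
  exists2 v, v \in reduced_words n & w = take (size w) v.
Proof.
have mem l s : size s = n ->
    take n (l :: scanl next_letter l s) \in reduced_words n.
  by move=> sn; apply: allpairs_f; rewrite ?mem_enum // mem_codes sn.
case: w => [|l w] /=.
  exists (take n ((true, true) :: scanl next_letter (true, true) (nseq n None))).
    by apply: mem; rewrite size_nseq.
  by rewrite take0.
move=> /scanl_next_surj[s <-]; rewrite size_scanl => sn.
exists (take n (l :: scanl next_letter l (s ++ nseq (n - size s) None))).
  by apply: mem; rewrite size_cat size_nseq subnKC // ltnW.
by rewrite take_takel //= scanl_cat take_cat size_scanl ltnn subnn take0 cats0.
Qed.

Lemma mem_reduced_words w : sorted noncancel w -> w \in reduced_words (size w).
Proof.
move=> sw; have [v vn {1}->] := reduced_words_prefix sw (leqnn _).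
suff -> : take (size w) v = v by [].
by have /allpairsP[[l s] [_ _ ->]] := vn; rewrite take_takel.
Qed.

(* Words without two consecutive [false]: their number is a Fibonacci number. *)
Fixpoint fib_words n : seq (seq bool) :=
  match n with
  | 0 => [:: [::]]
  | 1 => [:: [:: true]; [:: false]]
  | (n'.+1 as m).+1 =>
    [seq true :: s | s <- fib_words m] ++
    [seq [:: false, true & s] | s <- fib_words n']
  end.

Lemma mem_fib_words s : sorted orb s -> s \in fib_words (size s).
Proof.
have [n] := ubnP (size s); elim: n s => // n IH [|i [|j s]] //=.
  by case: i.
rewrite ltnS => sn /andP[ij /= ps]; rewrite mem_cat; apply/orP.
case: i ij => [_|/= jt]; [left|right].
  by apply: map_f; apply: (IH (j :: s)).
rewrite {}jt in ps *; apply: map_f; apply: IH; first exact: ltnW.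
exact: path_sorted ps.
Qed.

(** Padding with [true] never creates two adjacent [false]. *)
Lemma fib_words_prefix n s : sorted orb s -> size s <= n ->
  exists2 t, t \in fib_words n & s = take (size s) t.
Proof.
move=> so sn; exists (s ++ nseq (n - size s) true).
  have := @mem_fib_words (s ++ nseq (n - size s) true).
  rewrite size_cat size_nseq subnKC //; apply; case: s so {sn} => [|i s] /=.
    by case: (n - 0) => // k; rewrite /=; elim: k.
  rewrite cat_path => ->; elim: (n - _) (last i s) => //= k IH b.
  by rewrite orbT IH.
by rewrite take_size_cat.
Qed.

(** A superset is enough: all 16 pairs of letters are allowed, and the cyclic condition is relaxed
    to a linear one. *)
Definition positive_words n : seq (seq letter) :=
  [seq take k z | k <- iota 0 n.+1,
    z <- [seq spell lm.1 lm.2 t | lm <- enum {: letter * letter},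
                                 t <- fib_words n]].

(** Here [i] is the length of [c], which leaves [n - i.*2] letters for the middle. *)
Definition conj_words n : seq (seq letter) :=
  flatten [seq [seq c ++ z ++ winv c | c <- reduced_words i,
                                      z <- positive_words (n - i.*2)]
    | i <- iota 0 n./2.+1].

Lemma mem_positive_words n l m s : cycle orb s -> size s <= n ->
  spell l m s \in positive_words n.
Proof.
move=> cs sn; have so : sorted orb s.
  by case: s cs {sn} => //= i s; rewrite rcons_path => /andP[].
have [t tn ->] := fib_words_prefix so sn; rewrite /spell map_take.
apply: allpairs_f; first by rewrite mem_iota ltnS.
apply: (allpairs_f (fun lm t => spell lm.1 lm.2 t) (x := (l, m))) => //.
by rewrite ?mem_enum.
Qed.

Lemma mem_conj_words n c l m s : sorted noncancel c -> cycle orb s ->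
  (size c).*2 + size s <= n -> c ++ spell l m s ++ winv c \in conj_words n.
Proof.
move=> sc cs sn; apply/flatten_mapP; exists (size c).
  by rewrite mem_iota; lia.
apply: (allpairs_f (fun c z => c ++ z ++ winv c)); first exact: mem_reduced_words.
by apply: mem_positive_words => //; lia.
Qed.

Lemma size_conj_words n : size (conj_words n) =
  \sum_(0 <= i < n./2.+1)
    4 * 3 ^ i * ((n - i.*2).+1 * (16 * size (fib_words (n - i.*2)))).
Proof.
rewrite size_flatten /shape -map_comp sumnE big_map /index_iota subn0.
apply: eq_bigr => i _; rewrite /= size_allpairs size_reduced_words.
by rewrite !size_allpairs size_iota -cardE !card_prod card_bool.
Qed.

Lemma size_fib_words n : size (fib_words n.+2) =
  size (fib_words n.+1) + size (fib_words n).
Proof. by rewrite size_cat !size_map. Qed.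

(** * Roots of quadratically bounded sequences *)

Import Order.TTheory GRing.Theory Num.Theory.
Import numFieldNormedType.Exports.

Local Open Scope classical_set_scope.
Local Open Scope card_scope.

Section RootTest.
Local Open Scope ring_scope.
Variable R : realType.

(** With t = e N, exp t is at least (t/3)^3, by 1 + u <= exp u at u = t/3, and a cubic outgrows a
    quadratic. *)
Lemma ln_quadratic_le (K e : R) : 0 < K -> 0 < e ->
  \forall N \near \oo, ln (K * N.+1%:R ^+ 2) <= e * N%:R.
Proof.
move=> K0 e0; near=> N.
have N0 : (0 < N)%N by near: N; exact: nbhs_infty_gt.
have NR : 1 <= N%:R :> R by rewrite ler1n.
(* 108 is 4 * 27, from (N+1)^2 <= 4 N^2 and the cube of 3. *)
have big : 108%:R * K / e ^+ 3 <= N%:R by near: N; exact: nbhs_infty_ger.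
have pos : 0 < K * N.+1%:R ^+ 2 by rewrite mulr_gt0 // exprn_gt0.
rewrite -(expRK (e * N%:R)) ler_ln ?posrE ?expR_gt0 //.
have -> : e * N%:R = 3%:R * (e * N%:R / 3%:R) by field.
rewrite expRM_natl.
apply: (@le_trans _ _ ((e * N%:R / 3%:R) ^+ 3)); last first.
  rewrite lerXn2r ?nnegrE ?expR_ge0 //; first by rewrite !mulr_ge0 // ltW.
  by apply: le_trans (expR_ge1Dx _); rewrite lerDr.
have -> : N.+1%:R = N%:R + 1 :> R by rewrite -natr1.
move: big; rewrite ler_pdivrMr ?exprn_gt0 // => big.
apply: (@le_trans _ _ (K * (4%:R * N%:R ^+ 2))).
  by rewrite ler_wpM2l ?(ltW K0) //; nra.
have -> : (e * N%:R / 3%:R) ^+ 3 = (N%:R * e ^+ 3) * N%:R ^+ 2 / 27%:R by field.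
rewrite ler_pdivlMr //; apply: le_trans (ler_wpM2r _ big); last exact: exprn_ge0.
by lra.
Unshelve. all: by end_near.
Qed.

(** The logarithm of the root differs from [- ln r] by [ln (q N * r ^+ N)] divided by N, which tends
    to 0. *)
Lemma cvg_root (K r : R) (q : nat -> R) : 0 < K -> 0 < r ->
  (\forall N \near \oo,
    (K * N.+1%:R ^+ 2)^-1 <= q N * r ^+ N <= K * N.+1%:R ^+ 2) ->
  q N `^ N%:R^-1 @[N --> \oo] --> r^-1.
Proof.
move=> K0 r0 Hq.
have -> : r^-1 = expR (- ln r) by rewrite expRN lnK.
have : expR (N%:R^-1 * ln (q N)) @[N --> \oo] --> expR (- ln r).
  apply: continuous_cvg; first exact: continuous_expR.
  apply/cvgrPdist_le => e e0; near=> N.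
  have N0 : (0 < N)%N by near: N; exact: nbhs_infty_gt.
  have NR : 0 < N%:R :> R by rewrite ltr0n.
  have pos : 0 < K * N.+1%:R ^+ 2 by rewrite mulr_gt0 // exprn_gt0.
  have lnK : ln (K * N.+1%:R ^+ 2) <= e * N%:R by near: N; exact: ln_quadratic_le.
  have /andP[q1 q2] : (K * N.+1%:R ^+ 2)^-1 <= q N * r ^+ N <= K * N.+1%:R ^+ 2.
    by near: N.
  have p0 : 0 < q N * r ^+ N by apply: lt_le_trans q1; rewrite invr_gt0.
  have q0 : 0 < q N by move: p0; rewrite pmulr_lgt0 // exprn_gt0.
  have E : ln (q N * r ^+ N) = ln (q N) + ln r * N%:R.
    by rewrite lnM ?posrE ?exprn_gt0 // lnXn // mulr_natr.
  have l1 : ln (q N * r ^+ N) <= e * N%:R.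
    by apply: le_trans lnK; rewrite ler_ln ?posrE.
  have l2 : - (e * N%:R) <= ln (q N * r ^+ N).
    rewrite -lerN2 opprK -lnV ?posrE //; apply: le_trans lnK.
    by rewrite ler_ln ?posrE ?invr_gt0 // invf_ple ?posrE.
  have -> : - ln r - N%:R^-1 * ln (q N) = - (N%:R^-1 * ln (q N * r ^+ N)).
    by rewrite E; field; rewrite gt_eqF.
  rewrite normrN ler_norml mulrC ler_pdivlMr // ler_pdivrMr //.
  by rewrite mulNr l2 l1.
apply: cvg_trans; apply: near_eq_cvg; near=> N.
have /andP[q1 q2] : (K * N.+1%:R ^+ 2)^-1 <= q N * r ^+ N <= K * N.+1%:R ^+ 2.
  by near: N.
have pos : 0 < K * N.+1%:R ^+ 2 by rewrite mulr_gt0 // exprn_gt0.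
have p0 : 0 < q N * r ^+ N by apply: lt_le_trans q1; rewrite invr_gt0.
have q0 : 0 < q N by move: p0; rewrite pmulr_lgt0 // exprn_gt0.
by rewrite /powR gt_eqF.
Unshelve. all: by end_near.
Qed.
End RootTest.

(** * Free bases and primitive elements *)

Lemma card_eq2 (T : eqType) (A : set T) : A #= `I_2 ->
  exists x y, x <> y /\ A = [set x; y].
Proof.
move/eq_cardSP => [x Ax /eq_cardSP[y [Ay yx]]].
rewrite II0 card_eq0 => /eqP E; exists x, y; split; first by move=> /esym.
apply/seteqP; split=> [z Az|z [->|->]] //.
have [->|zx] := pselect (z = x); first by left.
have [->|zy] := pselect (z = y); first by right.
suff : set0 z by []. by rewrite -E.
Qed.

Lemma card_set2 (T : choiceType) (x y : T) : x <> y -> [set x; y] #= `I_2.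
Proof.
move=> xy; apply/eq_cardSP; exists x; first by left.
have -> : [set x; y] `\ x = [set y].
  apply/seteqP; split=> [z [[]]|z ->] //; split; [by right | by move/esym].
exact: card_set1.
Qed.

Section Basis.
Variables (G : groupType) (x y : G).
Hypothesis xy : x <> y.

Definition emb (l : letter) : G * bool := (if l.1 then y else x, l.2).

Lemma emb_inj : injective emb.
Proof.
by move=> [[] b] [[] c] [] /=;
  [move=> -> | move=> /esym/xy | move=> /xy | move=> ->].
Qed.

Lemma reduced_emb w : reduced (map emb w) = sorted noncancel w.
Proof.
rewrite /reduced sorted_map; apply: eq_sorted => l m /=.
have -> : ((emb l).1, ~~ (emb l).2) = emb (flip l) by [].
by rewrite /noncancel (inj_eq emb_inj).
Qed.

Lemma word_value_emb w : word_value (map emb w) = wval x y w.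
Proof. by rewrite /word_value big_map. Qed.

Lemma word_over_emb (w : word G) : word_over [set x; y] w ->
  exists w', w = map emb w'.
Proof.
elim: w => [|[g b] w IH] ow; first by exists [::].
have [|w' ->] := IH; first by move=> l lw; apply: ow; rewrite inE lw orbT.
have := ow (g, b); rewrite inE eqxx => /(_ isT) /= [->|->].
  by exists ((false, b) :: w').
by exists ((true, b) :: w').
Qed.

Lemma emb_over w : word_over [set x; y] (map emb w).
Proof. by move=> l /mapP[[[] b] _ ->]; [right|left]. Qed.

(** Turns the definition of a free basis into the normal form on which the reduction and the
    counting rest. *)
Lemma free_basis_nf : free_basis 2 [set x; y] -> exists nf : G -> seq letter,
  [/\ forall g, sorted noncancel (nf g), forall g, wval x y (nf g) = g,
      forall w, sorted noncancel w -> nf (wval x y w) = w &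
      forall g, word_length [set x; y] g = size (nf g)].
Proof.
move=> [_ free].
have /choice[nf nfP] : forall g, exists w : seq letter,
    [/\ sorted noncancel w, wval x y w = g &
    forall v, reduced_word_for [set x; y] g v -> v = map emb w].
  move=> g; have [v [[ov rv vg] uv]] := free g.
  have [w Ew] := word_over_emb ov; exists w; rewrite {}Ew in rv vg uv.
  split; [by rewrite -reduced_emb | by rewrite -word_value_emb |].
  by move=> u /uv.
have red w : sorted noncancel w ->
    reduced_word_for [set x; y] (wval x y w) (map emb w).
  move=> sw; split; [exact: emb_over | by rewrite reduced_emb |].
  exact: word_value_emb.
exists nf; split=> [g|g|w sw|g]; try by have [] := nfP g.
  have [_ _ /(_ _ (red _ sw))] := nfP (wval x y w).
  by move/(inj_map emb_inj).
rewrite /word_length; case: xgetP => [v -> rv|none].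
  by have [_ _ /(_ _ rv) ->] := nfP g; rewrite size_map.
have [sg Eg _] := nfP g; have := red _ sg; rewrite Eg => /none; by [].
Qed.
End Basis.

(** The values of words form a subgroup that contains [a] and [b]. *)
Lemma generates_gen2 (G : groupType) (a b : G) :
  generates [set a; b] -> gen2 a b.
Proof.
move=> gen g; have : [set: G] g by [].
rewrite -gen => /(_ [set h | exists w, wval a b w = h]); apply; split.
  split; first by exists [::]; rewrite wval_nil.
  by move=> _ _ [u <-] [v <-]; exists (u ++ winv v); rewrite wval_cat wval_winv.
by move=> _ [->|->]; [exists [:: (false, false)]|exists [:: (true, false)]];
  rewrite wval1.
Qed.

Lemma gen2_generates (G : groupType) (a b : G) :
  gen2 a b -> generates [set a; b].
Proof.
move=> gen; apply/seteqP; split=> // g _ H [[H1 Hdiv] Hab].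
have [w <-] := gen g; have HV z : H z -> H z^-1%g.
  by move=> Hz; rewrite -[z^-1%g]mul1g; exact: Hdiv.
have Ha : H a by apply: Hab; left.
have Hb : H b by apply: Hab; right.
elim: w => [|l w IH]; first by rewrite wval_nil.
rewrite wval_cons -[wval a b w]invgK; apply: Hdiv; last exact: HV.
by rewrite /lval; case: l.1; case: l.2 => //=; exact: HV.
Qed.

Lemma primitiveP (G : groupType) (g : G) : primitive 2 g ->
  exists b, gen2 g b.
Proof.
move=> [B [/card_eq2[a [b [_ ->]]] /generates_gen2 gen]] [->|->].
  by exists b.
exists a; apply: (gen2_sub gen).
  by exists [:: (true, false)]; rewrite wval1.
by exists [:: (false, false)]; rewrite wval1.
Qed.

Lemma card_fset_set_le (T : choiceType) (L : seq T) (A : set T) :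
  (forall g, A g -> g \in L) -> finite_set A /\ (#|` fset_set A| <= size L)%N.
Proof.
move=> sub; have finA : finite_set A.
  apply: (sub_finite_set _ (finite_fset [fset g in L]%fset)) => g /sub gL.
  by rewrite /= inE.
split=> //; apply: leq_trans (size_undup L); rewrite -card_fseq.
apply: fsubset_leq_card; apply/fsubsetP => g; rewrite in_fset_set // inE => /sub gL.
by rewrite inE.
Qed.

Lemma card_fset_set_ge (T : choiceType) (L : seq T) (A : set T) :
  uniq L -> finite_set A -> (forall g, g \in L -> A g) ->
  (size L <= #|` fset_set A|)%N.
Proof.
move=> uL finA sub; rewrite -(undup_id uL) -card_fseq.
apply: fsubset_leq_card; apply/fsubsetP => g; rewrite inE => /sub Ag.
by rewrite in_fset_set // inE.
Qed.

(** * Counting in balls *)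

Section Counting.
Variables (G : groupType) (x y : G) (nf : G -> seq letter).
Hypothesis xy : x <> y.
Hypothesis nf_sorted : forall g, sorted noncancel (nf g).
Hypothesis nfK : forall g, wval x y (nf g) = g.
Hypothesis wvalK : forall w, sorted noncancel w -> nf (wval x y w) = w.
Hypothesis lenE : forall g, word_length [set x; y] g = size (nf g).
Let X : set G := [set x; y].
Let P : set G := [set g | primitive 2 g].

Lemma ball_le n : finite_set [set g | [set: G] g /\ (word_length X g <= n)%N] /\
  (ball_count X [set: G] n <= n.+1 * (4 * 3 ^ n))%N.
Proof.
pose L := [seq wval x y w |
  w <- [seq take k w | k <- iota 0 n.+1, w <- reduced_words n]].
have <- : size L = (n.+1 * (4 * 3 ^ n))%N.
  by rewrite size_map size_allpairs size_iota size_reduced_words.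
apply: card_fset_set_le => g [_]; rewrite lenE => gn.
have [v vn E] := reduced_words_prefix (nf_sorted g) gn.
apply/mapP; exists (nf g); last by rewrite nfK.
by rewrite E; apply: allpairs_f => //; rewrite mem_iota ltnS.
Qed.

Lemma ball_ge n : (3 ^ n <= ball_count X [set: G] n)%N.
Proof.
(* [l] is not part of the words; it only restricts their first letter. *)
pose l : letter := (true, true).
pose L := [seq wval x y (scanl next_letter l s) | s <- codes n].
have sl s : sorted noncancel (scanl next_letter l s).
  exact: path_sorted (path_scanl_next l s).
have <- : size L = (3 ^ n)%N by rewrite size_map size_codes.
apply: card_fset_set_ge.
- rewrite map_inj_uniq ?codes_uniq // => s t /(congr1 nf).
  by rewrite !wvalK // => /scanl_next_inj.
- by have [] := ball_le n.
- move=> _ /mapP[s + ->]; rewrite mem_codes => /eqP sn.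
  by split=> //; rewrite lenE wvalK // size_scanl sn.
Qed.

Lemma primitive_conj g : gen2 x y -> primitive 2 (x ^ g)%g.
Proof.
move=> gen; exists [set (x ^ g)%g; (y ^ g)%g].
split; [|exact/gen2_generates/gen2J|by left].
by apply: card_set2 => /conjg_inj.
Qed.

Lemma finite_prim_ball n : finite_set [set g | P g /\ (word_length X g <= n)%N].
Proof. by have [+ _] := ball_le n; apply: sub_finite_set => g []. Qed.

(** Conjugates of [x] by words [u] of length k+1 starting with the inverse of [y] are reduced as
    written, of length 2(k+1)+1. *)
Lemma primitive_ball_ge n k : (k.*2 + 3 <= n)%N -> (3 ^ k <= ball_count X P n)%N.
Proof.
move=> kn; pose l : letter := (true, true).
pose u s := l :: scanl next_letter l s.
pose v s := winv (u s) ++ (false, false) :: u s.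
have sv s : sorted noncancel (v s).
  have su : sorted noncancel (u s) by exact: path_scanl_next.
  rewrite /v /u winv_cons sorted_rcons_cat -winv_cons.
  by rewrite sorted_winv su /= path_scanl_next.
have Ev s : wval x y (v s) = (x ^ wval x y (u s))%g.
  by rewrite wval_cat wval_cons wval_winv conjgE.
pose L := [seq wval x y (v s) | s <- codes k].
have <- : size L = (3 ^ k)%N by rewrite size_map size_codes.
apply: card_fset_set_ge; last first.
- move=> _ /mapP[s + ->]; rewrite mem_codes => /eqP sn; split.
    by rewrite Ev; apply: primitive_conj => // g; exists (nf g).
  by rewrite lenE wvalK // size_cat size_winv /= size_scanl sn; lia.
- exact: finite_prim_ball.
rewrite map_inj_in_uniq ?codes_uniq // => s t.
rewrite !mem_codes => /eqP sk /eqP tk.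
move=> /(congr1 nf); rewrite !wvalK // => /eqP; rewrite eqseq_cat.
  by case/andP=> _ /eqP[] /scanl_next_inj.
by rewrite !size_winv /= !size_scanl sk tk.
Qed.

Lemma primitive_ball_le n : (ball_count X P n <= size (conj_words n))%N.
Proof.
pose L := [seq wval x y w | w <- conj_words n].
have <- : size L = size (conj_words n) by rewrite size_map.
apply: (card_fset_set_le _).2 => g [/primitiveP[b gen]]; rewrite lenE => gn.
(* The reduction starts from the pair [(g, b)], in which [g] is itself a letter. *)
have : conj_christoffel x y g.
  apply: (gen_christoffel_basis nf_sorted nfK wvalK (a := g) (b := b)); split=> //.
  apply: (@christoffel_conj _ _ _ false false); exact: Christoffel_l.
case/conj_christoffel_word=> c [l [m [s [lm s0 cs E]]]].
have [c' [s' [sz cs' red Ew]]] :=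
  @conj_word_reduced _ x y l m s (nf c) lm s0 cs (nf_sorted c).
rewrite nfK -E in Ew; apply/mapP; exists (c' ++ spell l m s' ++ winv c') => //.
apply: mem_conj_words => //; first by move: red => /cat_sorted2[].
by move: gn; rewrite Ew wvalK // !size_cat size_winv size_map; lia.
Qed.

End Counting.

(** * Estimates in powers of the square root of 3 *)

Section Bounds.
Variable R : realType.
Local Notation r := (Num.sqrt (3 : R)).
Local Open Scope ring_scope.

Lemma sqr_sqrt3 : r ^+ 2 = 3.
Proof. by rewrite sqr_sqrtr. Qed.

Lemma sqrt3_ge1 : 1 <= r.
Proof. by rewrite -{1}sqrtr1 ler_wsqrtr // ler1n. Qed.

Lemma natr_exp3 k : (3 ^ k)%:R = r ^+ k.*2 :> R.
Proof. by rewrite natrX -muln2 mulnC exprM sqr_sqrt3. Qed.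

(** Since r <= 2, r + 1 <= 3 = r^2, so powers of r dominate the Fibonacci recurrence. *)
Lemma size_fib_words_le n : (size (fib_words n))%:R <= 2 * r ^+ n.
Proof.
have [m] := ubnP n; elim: m n => // m IH [|[|n]] nm.
- by rewrite expr0 mulr1 ler_nat.
- by rewrite expr1; have := sqrt3_ge1; rewrite -[(size _)%:R]/(2%:R); lra.
rewrite size_fib_words natrD.
have h1 := IH n.+1 nm; have h2 := IH n (ltnW nm).
apply: le_trans (lerD h1 h2) _; rewrite !exprS.
have rn : 0 <= r ^+ n by rewrite exprn_ge0 // sqrtr_ge0.
have : r * (r * r ^+ n) = 3 * r ^+ n by rewrite mulrA -expr2 sqr_sqrt3.
have : r <= 2 by have := sqr_sqrt3; have := sqrt3_ge1; nra.
by nra.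
Qed.

(** Each [i] contributes at most a multiple of r^(2i) r^(n-2i) = r^n. The constant is 128 = 4 * 16 *
    2; one factor n+1 comes from the prefix lengths, the other from the values of [i]. *)
Lemma size_conj_words_le n :
  (size (conj_words n))%:R <= 128 * n.+1%:R ^+ 2 * r ^+ n.
Proof.
rewrite size_conj_words natr_sum.
apply: (@le_trans _ _ (\sum_(0 <= i < n./2.+1) 128 * n.+1%:R * r ^+ n)); last first.
  rewrite sumr_const_nat subn0 -[leLHS]mulr_natr.
  have : n./2.+1%:R <= n.+1%:R :> R by rewrite ler_nat; lia.
  have : 0 <= r ^+ n by rewrite exprn_ge0 // sqrtr_ge0.
  have : 0 <= n.+1%:R :> R by [].
  move=> n0 rn le.
  rewrite [leRHS](_ : _ = 128 * n.+1%:R * r ^+ n * n.+1%:R); last by ring.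
  by rewrite ler_wpM2l ?mulr_ge0.
apply: ler_sum_nat => i /andP[_ ile].
have -> : r ^+ n = r ^+ i.*2 * r ^+ (n - i.*2) by rewrite -exprD subnKC //; lia.
rewrite !natrM natr_exp3.
have := size_fib_words_le (n - i.*2); set f := (size _)%:R => fle.
have le1 : (n - i.*2).+1%:R <= n.+1%:R :> R by rewrite ler_nat; lia.
have : 0 <= r ^+ i.*2 by rewrite exprn_ge0 // sqrtr_ge0.
set a := r ^+ i.*2 => a0.
rewrite [leLHS](_ : _ = 64 * a * ((n - i.*2).+1%:R * f)); last by ring.
rewrite [leRHS](_ : _ = 64 * a * (n.+1%:R * (2 * r ^+ (n - i.*2)))); last by ring.
by rewrite ler_wpM2l ?mulr_ge0 // ler_pM.
Qed.
(** Used with a = r^N and n = N+1. The quotient lies between 1/(36 n) and 128 n^2, and 128 n^2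
    serves for both bounds. *)
Lemma ratio_bounds (a n p b : R) : 0 < a -> 0 < b -> 1 <= n ->
  a * a <= b <= 4 * n * (a * a) -> a <= 9 * p <= 9 * (128 * n ^+ 2 * a) ->
  (128 * n ^+ 2)^-1 <= p / b * a <= 128 * n ^+ 2.
Proof.
move=> a0 b0 n1 /andP[bl bu] /andP[pl]; rewrite ler_pM2l // => pu.
have n0 : 0 < 128 * n ^+ 2 by rewrite mulr_gt0 // exprn_gt0 // (lt_le_trans _ n1).
rewrite mulrAC ler_pdivrMr // ler_pdivlMr //; apply/andP; split; last first.
  apply: le_trans (ler_wpM2l (ltW n0) bl).
  by rewrite mulrA ler_wpM2r // ltW.
rewrite mulrC ler_pdivrMr //; apply: (le_trans bu).
have h : a * a <= 9 * p * a by rewrite ler_wpM2r // ltW.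
apply: (@le_trans _ _ (4 * n * (9 * p * a))); first by rewrite ler_wpM2l //; lra.
have pa : 0 <= p * a by rewrite mulr_ge0 //; lra.
have -> : 4 * n * (9 * p * a) = p * a * (36 * n) by ring.
by rewrite ler_wpM2l //; nra.
Qed.
End Bounds.

Theorem theorem0p1 (R : realType) (G : groupType) (X : set G)
    (hX : free_basis 2 X) :
  growth_rate R X [set g : G | primitive 2 g]%classic
  = (1 / Num.sqrt (3 : R))%R%:E.
Proof.
have [x [y [xy EX]]] := card_eq2 hX.1; subst X.
have [nf [sorted_nf nfK wvalK lenE]] := free_basis_nf xy hX.
rewrite /growth_rate; set r : R := Num.sqrt 3.
(* The sequence converges, so its upper limit is its limit. *)
rewrite div1r; apply: (cvg_limn_einf_sup _).2.
apply: cvg_EFin; first exact: nearW.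
apply: (@cvg_root R 128%R); rewrite ?sqrtr_gt0 ?ltr0n //.
near=> N.
have N3 : (3 <= N)%N by near: N; exact: nbhs_infty_ge.
set p := ball_count _ [set g | _] N; set b := ball_count _ _ N.
have r0 : (0 < r)%R by rewrite sqrtr_gt0 ltr0n.
have pu : (p%:R <= 128 * N.+1%:R ^+ 2 * r ^+ N :> R)%R.
  apply: le_trans (size_conj_words_le R N).
  rewrite ler_nat; exact: primitive_ball_le.
have pl : (r ^+ N <= 9 * p%:R :> R)%R.
  (* The largest [k] with 2k+3 <= N. As 2k >= N-4, the loss is at most r^4 = 9. *)
  pose k := ((N - 3)./2)%N.
  have : (3 ^ k <= p)%N by apply: (primitive_ball_ge xy) => //; rewrite /k; lia.
  rewrite -(ler_nat R) natr_exp3 -/r => le.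
  apply: le_trans (ler_wpM2l _ le); last by [].
  have -> : (9 : R)%R = (r ^+ 4)%R by rewrite (exprM r 2 2) sqr_sqrt3; ring.
  by rewrite -exprD ler_weXn2l ?sqrt3_ge1 // /k; lia.
have bl : (r ^+ N * r ^+ N <= b%:R :> R)%R.
  by rewrite -exprD addnn -natr_exp3 ler_nat; exact: ball_ge.
have bu : (b%:R <= 4 * N.+1%:R * (r ^+ N * r ^+ N) :> R)%R.
  have [_] := ball_le sorted_nf nfK lenE N.
  rewrite -(ler_nat R) => /le_trans; apply.
  by rewrite !natrM natr_exp3 -addnn exprD mulrCA mulrA.
have a0 : (0 < r ^+ N)%R by rewrite exprn_gt0.
have b0 : (0 < b%:R :> R)%R by apply: lt_le_trans bl; rewrite mulr_gt0.
have n1 : (1 <= N.+1%:R :> R)%R by rewrite ler1n.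
by apply: ratio_bounds; rewrite ?bl ?pl //= ler_pM2l // ltr0n.
Unshelve. all: by end_near.
Qed.
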